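(* Let $W$ be a set and let $\mathcal{F}$ be a set of subsets of $W$. Then there is a linear ordering $<$ of $W$ such that each member of $\mathcal{F}$ is an interval under this ordering, if and only if there do not exist distinct $v_1,v_2,v_3\in W$ and $\mathcal{F}$-connected subsets $X_1,X_2,X_3$ of $W$ such that for all $i,j\in\{1,2,3\}$, $v_i\in X_j$ if and only if $i\ne j$.
   Context: The set $W$ may be infinite. Given a set $\mathcal{F}$ of subsets of $W$, a subset $X\subseteq W$ is $\mathcal{F}$-connected if for every partition $(A,B)$ of $X$ into two nonempty sets $A,B$, there exists $S\in\mathcal{F}$ with $S\subseteq X$ such that $S\cap A\neq\emptyset$ and $S\cap B\neq\emptyset$. A linear ordering is a strict total order. A subset $S\subseteq W$ is an interval under a linear ordering $<$ of $W$ if it is order-convex: whenever $a,c\in S$ and $b\in W$ with $a<b<c$, then $b\in S$ (the empty set counts as an interval; no endpoints need exist). *)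

(* Defs.v *)
From Corelib Require Import RelationClasses.
From mathcomp Require Import all_boot.
From mathcomp Require Import classical_sets.

Set Implicit Arguments.
Unset Strict Implicit.
Unset Printing Implicit Defensive.

Local Open Scope classical_set_scope.

Definition F_connected (W : Type) (F : set (set W)) (X : set W) : Prop :=
  forall A B : set W,
    A `|` B = X -> A `&` B = set0 -> A !=set0 -> B !=set0 ->
    exists S : set W,
      [/\ F S, S `<=` X, S `&` A !=set0 & S `&` B !=set0].

Definition linear_ordering (W : Type) (lt : W -> W -> Prop) : Prop :=
  StrictOrder lt /\ forall x y : W, x <> y -> lt x y \/ lt y x.

Definition order_interval (W : Type) (lt : W -> W -> Prop) (S : set W) : Prop :=
  forall a b c : W, S a -> S c -> lt a b -> lt b c -> S b.

(* Main.v *)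
(** Say that [x] and [y] are linked around [v] when some F-connected set contains
[x] and [y] but not [v]; then [v] must not lie between [x] and [y].
These constraints form an equivalence relation for each [v], a connected set
witnessing one of them either contains a given [w] or avoids it, and the
excluded configuration consists of three points any two of which are linked
around the third. These three properties alone suffice.

For finitely many points, take [p] and a class [K] of the relation at [p] with
[K] as large as possible. If [K] misses only [p], then [p] can be made an end of
the order; otherwise the complement of [K] is a module, which is contracted to
[p] and ordered separately. An ultrafilter on the finite sets of points glues
the finite orders into an order of [W]. *)

Require Import Defs.
From mathcomp Require Import all_boot zify.

Set Implicit Arguments.
Unset Strict Implicit.

(* [L v x y] stands for: [x] and [y] are linked around [v]. *)
Record separation (T : Type) (L : T -> T -> T -> Prop) : Prop := Separation {
  sep_neq : forall v x y, L v x y -> x <> v;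
  sep_refl : forall v x, x <> v -> L v x x;
  sep_sym : forall v x y, L v x y -> L v y x;
  sep_trans : forall v x y z, L v x y -> L v y z -> L v x z;
  sep_split : forall w v x y, L v x y -> L v x w \/ L w x y;
  sep_asteroid : forall v x y, L v x y -> L x v y -> L y v x -> False }.

(** * Ranking a finite set of points *)

Section FiniteRank.

Variables (T : finType) (L : T -> T -> T -> bool).
Hypothesis sepL : separation (fun v x y => L v x y).

Local Open Scope nat_scope.
Implicit Types (A B D : {set T}) (f : T -> nat).

(** As [L] is symmetric and [f] injective on [A], the one-sided clause keeps linked [x] and [y] on
    the same side of [v]. *)
Definition ranking A f :=
  {in A &, injective f} /\
  {in A & A & A, forall v x y, L v x y -> f x < f v -> f y < f v}.

Lemma ranking_flip A f : ranking A f -> ranking A (fun x => \max_y f y - f x).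
Proof.
have fle x : f x <= \max_y f y by exact: leq_bigmax.
move=> [finj fL]; split=> [x y xA yA e|v x y vA xA yA Lxy lt_xv].
  by apply: finj => //; have := fle x; have := fle y; lia.
have Lyx := sep_sym sepL Lxy.
have fyv : f y <> f v.
  by move=> /(finj _ _ yA vA); exact: (sep_neq sepL Lyx).
have := fL v y x vA yA xA Lyx; have := fle x; have := fle y; have := fle v.
lia.
Qed.

(** The other points are pairwise linked around [t], hence all lie on one side of it; if they lie
    above, the order is reversed. *)
Lemma ranking_last A f t : ranking A f -> t \in A ->
    {in A :\ t &, forall x y, L t x y} ->
  exists2 g, ranking A g & {in A :\ t, forall x, g x < g t}.
Proof.
move=> gf tA Lt; have [finj fL] := gf.
have [/existsP[m /andP[mAt lt_mt]]|] := boolP [exists m, (m \in A :\ t) && (f m < f t)].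
  exists f => // x xAt; move: (mAt) (xAt); rewrite !inE => /andP[_ mA] /andP[_ xA].
  exact: (fL t m x tA mA xA (Lt _ _ mAt xAt)).
rewrite negb_exists => /forallP fge.
exists (fun x => \max_y f y - f x); first exact: ranking_flip.
move=> x xAt; have := fge x; rewrite xAt /= => fx.
move: (xAt); rewrite !inE => /andP[/eqP xt xA].
have fxt : f x <> f t by move=> /(finj _ _ xA tA).
have : f x <= \max_y f y by exact: leq_bigmax.
lia.
Qed.

Lemma ranking_first A f t : ranking A f -> t \in A ->
    {in A :\ t &, forall x y, L t x y} ->
  exists2 g, ranking A g & {in A :\ t, forall x, g t < g x}.
Proof.
move=> gf tA Lt; have [g gg g_last] := ranking_last gf tA Lt.
exists (fun x => \max_y g y - g x); first exact: ranking_flip.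
move=> x /g_last lt_xt; have : g t <= \max_y g y by exact: leq_bigmax.
lia.
Qed.

(* [D] is a module: a connected set meeting both [D] and its complement
   contains [D]. Hence [D] may be collapsed to [p] and later expanded. *)
Lemma ranking_module A D p g h : D \subset A -> p \in D ->
    {in D & D & A :\: D, forall v x y, ~~ L v x y} ->
    ranking D g -> ranking (p |: A :\: D) h -> exists f, ranking A f.
Proof.
move=> /subsetP sDA pD modD [ginj gL] [hinj hL].
(* [N] exceeds all values of [g], so [N * h (pi x) + c x] sorts by collapsed point first and by [g]
   inside [D]. *)
pose N := (\max_y g y).+1.
pose pi x := if x \in D then p else x.
have gN x : g x < N by rewrite ltnS; exact: leq_bigmax.
pose c x := if x \in D then g x else 0.
have cN x : c x < N by rewrite /c; case: ifP.
have piA x : x \in A -> pi x \in p |: A :\: D.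
  by rewrite /pi !inE; case: ifP => [_ _|-> ->]; rewrite ?eqxx ?orbT.
exists (fun x => N * h (pi x) + c x).
have hlt x y : h (pi x) < h (pi y) -> N * h (pi x) + c x < N * h (pi y) + c y.
  move=> lt_xy; have := cN x.
  have : N * (h (pi x)).+1 <= N * h (pi y) by rewrite leq_mul2l lt_xy orbT.
  rewrite mulnS; lia.
split=> [x y xA yA e|v x y vA xA yA Lxy].
  have hxy : h (pi x) = h (pi y).
    by case: (ltngtP (h (pi x)) (h (pi y))) => // /hlt; lia.
  have := hinj _ _ (piA _ xA) (piA _ yA) hxy.
  have cxy : c x = c y by move: e; rewrite hxy; lia.
  move: cxy; rewrite /c /pi; case: ifP => xD; case: ifP => yD //.
  - by move=> gxy _; exact: ginj.
  - by move=> _ py; rewrite -py pD in yD.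
  - by move=> _ px; rewrite px pD in xD.
have Lyx := sep_sym sepL Lxy.
have [/and3P[vD xD yD]|ND] := boolP [&& v \in D, x \in D & y \in D].
  by rewrite /pi /c vD xD yD !ltn_add2l; exact: gL.
have outD z : z \in A -> z \notin D -> z \in A :\: D by move=> zA zD; rewrite inE zD.
(* Where splitting at [p] is needed, the unwanted alternative links a point of [D] to one outside
   around a point of [D], against [modD]. *)
have Lpi : L (pi v) (pi x) (pi y).
  rewrite /pi; case: ifPn => vD; case: ifPn => xD; case: ifPn => yD.
  - by rewrite vD xD yD in ND.
  - by have := modD _ _ _ vD xD (outD _ yA yD); rewrite Lxy.
  - by have := modD _ _ _ vD yD (outD _ xA xD); rewrite Lyx.
  - have [//|] := sep_split sepL p Lxy; last by [].
    move=> /(sep_sym sepL) Lpx.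
    by have := modD _ _ _ vD pD (outD _ xA xD); rewrite Lpx.
  - by apply: (sep_refl sepL) => pv; rewrite -pv pD in vD.
  - have [|] := sep_split sepL p Lxy.
      by move=> /(sep_sym sepL) Lpx; exact: (sep_trans sepL Lpx Lxy).
    by move=> Lp; have := modD _ _ _ pD xD (outD _ yA yD); rewrite Lp.
  - have [|] := sep_split sepL p Lyx.
      by move=> Lyp; exact: (sep_trans sepL Lxy Lyp).
    by move=> Lp; have := modD _ _ _ pD yD (outD _ xA xD); rewrite Lp.
  - by [].
move=> lt_xv; apply/hlt.
apply: (hL _ _ _ (piA _ vA) (piA _ xA) (piA _ yA) Lpi).
have : h (pi x) <> h (pi v).
  by move=> /(hinj _ _ (piA _ xA) (piA _ vA)); exact: (sep_neq sepL Lpi).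
case: (ltngtP (h (pi x)) (h (pi v))) => // /hlt; lia.
Qed.

(* With [e] as an end, [L m e x] forces [x] to precede [m]: [M] collects the
   elements that nothing is forced to precede, and [t] is a first element of
   the rest. *)
Lemma ranking_end A e :
    (forall B : {set T}, #|B| < #|A| -> exists f, ranking B f) ->
    e \in A -> {in A :\ e &, forall x y, L e x y} -> exists f, ranking A f.
Proof.
move=> IH eA Le; set B := A :\ e.
pose M := [set m in B | [forall x in B, ~~ L m e x]].
have BA x : x \in B -> x \in A by rewrite inE => /andP[].
have inA x : x \in A -> x = e \/ x \in B.
  by move=> xA; rewrite !inE xA andbT; case: eqP; [left|right].
have ltBA : #|B| < #|A| by rewrite [#|A|](cardsD1 e) eA.
have MB x : x \in M -> x \in B by rewrite inE => /andP[].
have ML m x : m \in M -> x \in B -> ~~ L m e x.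
  by rewrite inE => /andP[_ /'forall_implyP]; apply.
have eNB : e \notin B by rewrite !inE eqxx.
have [TM0|] := eqVneq (B :\: M) set0.
  have sBM x : x \in B -> x \in M.
    by move=> xB; apply: contraT => xM; have := in_set0 x; rewrite -TM0 inE xM xB.
  have [g [ginj gL]] := IH _ ltBA.
  pose f x := if x == e then 0 else (g x).+1.
  have fB x : x \in B -> f x = (g x).+1.
    by rewrite /f !inE => /andP[/negPf->].
  have fe : f e = 0 by rewrite /f eqxx.
  exists f; split=> [x y|v x y vA xA yA Lxy].
    move=> /inA[->|xB] /inA[->|yB] //; rewrite ?fe ?fB // => -[]; exact: ginj.
  have [->|vB] := inA _ vA; first by rewrite fe.
  have [Ey|yB] := inA _ yA; first by rewrite Ey fe (fB v).
  have [Ex|xB] := inA _ xA.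
    by have := ML _ _ (sBM _ vB) yB; rewrite -Ex Lxy.
  by rewrite !fB // !ltnS; exact: gL.
case/set0Pn=> t0 t0T.
pose C t := [set x in B | L t e x].
have [t tT tmin] := @arg_minnP _ t0 (mem (B :\: M)) (fun t => #|C t|) t0T.
have /setDP[tB tM] : t \in B :\: M := tT.
(* If [y] were forced before [t], [C y] would be a proper subset of [C t]: splitting at [t], the
   alternative [L y e t] completes a forbidden triple. *)
have tmin' y : y \in B :\: M -> ~~ L t e y.
  move=> yT; apply/negP => Lty; have /setDP[yB yM] := yT.
  have := tmin y yT; rewrite leqNgt => /negP; apply.
  apply/proper_card/properP; split; last first.
    exists y; rewrite !inE ?Lty ?andbT; first by move: yB; rewrite !inE.
    by apply/negP => /andP[_ /(sep_sym sepL) /(sep_neq sepL)].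
  apply/subsetP => x; rewrite inE => /andP[xB Lyx]; rewrite inE xB /=.
  have [Lyt|//] := sep_split sepL t Lyx.
  by case: (sep_asteroid sepL (Le _ _ tB yB) Lty Lyt).
(* Every point of [M] is forced before every point of [B :\: M], which dictates the order: [e], then
   [M], then the rest. *)
have MT m y : m \in M -> y \in B :\: M -> L y e m.
  move=> mM; rewrite [y \in _]inE => /andP[yM yB]; move: yM.
  rewrite inE yB /= => /forall_inPn[z zB]; rewrite negbK => Lyz.
  have [//|Lmz] := sep_split sepL m Lyz.
  by have := ML _ _ mM zB; rewrite Lmz.
(* [m0] makes [e |: B :\: M] smaller than [A], as the induction requires. *)
have [m0 m0M] : exists m, m \in M.
  move: tM; rewrite inE tB /= => /forall_inPn[z zB]; rewrite negbK => Ltz.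
  exists z; apply: contraT => zM; have := tmin' z; rewrite Ltz inE zM zB.
  by apply.
(* In constraints on two points [v], [x] of [M], [t] stands for all of [B :\: M]; hence [t |: M] is
   ranked with [t] last. *)
have Lt v x y : v \in M -> x \in M -> y \in B :\: M -> L v x y -> L v x t.
  move=> vM xM yT Lxy; have [Lyt|Lyx] := sep_split sepL t (sep_sym sepL Lxy).
    exact: (sep_trans sepL Lxy Lyt).
  have := tmin' _ yT.
  by rewrite (sep_trans sepL (MT _ _ xM tT) (sep_sym sepL Lyx)).
have [|g0 gg0] := IH (t |: M).
  apply: leq_ltn_trans ltBA; apply/subset_leq_card/subsetP => x.
  by rewrite in_setU1 => /orP[/eqP->|/MB].
have [|g [ginj gL] glast] := ranking_last gg0 (setU11 _ _).
  move=> x y; rewrite !in_setD1 !in_setU1.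
  move=> /andP[/negPf-> /= xM] /andP[/negPf-> /= yM].
  exact: (sep_trans sepL (sep_sym sepL (MT _ _ xM tT)) (MT _ _ yM tT)).
have [|h0 gh0] := IH (e |: B :\: M).
  apply/proper_card/properP; split.
    by apply/subsetP => x; rewrite in_setU1 => /orP[/eqP->//|/setDP[/BA]].
  exists m0; first exact/BA/MB.
  rewrite in_setU1 in_setD m0M orbF; apply: contra eNB => /eqP<-.
  exact: MB.
have [|h [hinj hL] hfirst] := ranking_first gh0 (setU11 _ _).
  move=> x y; rewrite !in_setD1 !in_setU1.
  move=> /andP[/negPf-> /= /setDP[xB _]] /andP[/negPf-> /= /setDP[yB _]].
  exact: Le.
(* The ranks [(g x).+1] of [M] lie strictly between 0, the rank of [e], and [N], where the rest
   begins. *)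
pose N := (\max_y g y).+2.
have gN x : (g x).+1 < N by rewrite !ltnS; exact: leq_bigmax.
clearbody N.
have gNh x n : (g x).+1 < N + n := ltn_addr n (gN x).
pose f x := if x == e then 0 else if x \in M then (g x).+1 else N + h x.
have fe : f e = 0 by rewrite /f eqxx.
have Bne x : x \in B -> (x == e) = false.
  by move=> xB; apply: contraNF eNB => /eqP<-.
have fM x : x \in M -> f x = (g x).+1.
  by move=> xM; rewrite /f xM Bne //; exact: MB.
have fT x : x \in B :\: M -> f x = N + h x.
  by move=> /setDP[xB xM]; rewrite /f Bne // (negPf xM).
have {}inA x : x \in A -> [\/ x = e, x \in M | x \in B :\: M].
  move=> /inA[->|xB]; first by constructor 1.
  by have [xM|xM] := boolP (x \in M); [constructor 2|constructor 3; rewrite inE xM].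
have hT x : x \in B :\: M -> h e < h x.
  by move=> xT; have /setDP[xB xM] := xT; apply: hfirst; rewrite in_setD1 in_setU1 Bne // xT.
have gM x : x \in M -> g x < g t.
  move=> xM; apply: glast; rewrite in_setD1 in_setU1 xM orbT andbT.
  by apply: contra tM => /eqP<-.
exists f; split=> [x y|v x y vA xA yA Lxy].
  move=> /inA[->|xM|xT] /inA[->|yM|yT] //.
  - by rewrite fe (fM y).
  - by rewrite fe (fT y) // => E; have := gNh e (h y); rewrite -E.
  - by rewrite fe (fM x).
  - by rewrite (fM x) // (fM y) // => -[gxy]; apply: ginj; rewrite // in_setU1 ?xM ?yM orbT.
  - by rewrite (fM x) // (fT y) // => E; have := gNh x (h y); rewrite E ltnn.
  - by rewrite fe (fT x) // => E; have := gNh e (h x); rewrite E.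
  - by rewrite (fT x) // (fM y) // => E; have := gNh y (h x); rewrite E ltnn.
  - by rewrite (fT x) // (fT y) // => /addnI hxy; apply: hinj; rewrite // in_setU1 ?xT ?yT orbT.
have [->|vM|vT] := inA _ vA; first by rewrite fe.
  rewrite (fM v) //.
  have [->|yM|yT] := inA _ yA; first by rewrite fe.
    rewrite (fM y) //; have [xe|xM|xT] := inA _ xA.
    - by have := ML _ _ vM (MB _ yM); rewrite -xe Lxy.
    - by rewrite fM // !ltnS; apply: gL => //; rewrite in_setU1 ?xM ?yM ?vM orbT.
    - by rewrite (fT x) // ltnNge ltnW.
  have /setDP[yB _] := yT.
  have [xe|xM|xT] := inA _ xA.
  - by have := ML _ _ vM yB; rewrite -xe Lxy.
  - rewrite (fM x) // ltnS => lt_xv.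
    have : g t < g v.
      by apply: (gL v x t) lt_xv; rewrite ?in_setU1 ?eqxx ?xM ?vM ?orbT //; exact: Lt Lxy.
    by rewrite ltnNge ltnW // gM.
  - by rewrite (fT x) // ltnNge ltnW.
rewrite (fT v) //.
have [->|yM|yT] := inA _ yA.
- by move=> _; rewrite fe; exact: leq_ltn_trans (gNh e (h v)).
- by rewrite (fM y).
rewrite (fT y) // ltn_add2l.
have eT : e \in e |: B :\: M := setU11 _ _.
have TT z : z \in B :\: M -> z \in e |: B :\: M by move=> zT; rewrite in_setU1 zT orbT.
have [xe|xM|xT] := inA _ xA.
- by move=> _; apply: (hL v e y); rewrite // ?TT ?hT // -xe.
(* By [MT], [x] is linked to [e] around [v], so [e] replaces it in the ranking [h]. *)
- move=> _; apply: (hL v e y); rewrite // ?TT ?hT //.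
  exact: (sep_trans sepL (MT _ _ xM vT) Lxy).
- by rewrite fT // ltn_add2l; apply: hL; rewrite ?TT.
Qed.

Lemma ranking_exists A : exists f, ranking A f.
Proof.
have [n] := ubnP #|A|; elim: n A => // n IHn A; rewrite ltnS => leAn.
have IH (B : {set T}) : #|B| < #|A| -> exists f, ranking B f.
  by move=> ltBA; apply: IHn; exact: leq_trans leAn.
have [/existsP[e /andP[eA /'forall_implyP Le]]|] :=
    boolP [exists e, (e \in A) && [forall x in A :\ e, [forall y in A :\ e, L e x y]]].
  apply: (ranking_end IH eA) => x y xAe yAe.
  by have /'forall_implyP := Le x xAe; apply.
rewrite negb_exists => /forallP noend.
have [/eqP A0|/set0Pn[p0 p0A]] := boolP (A == set0).
  by exists (fun=> 0); split=> x; rewrite A0 inE.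
have := noend p0; rewrite p0A /= => /forall_inPn[x0 x0A _].
pose K p x := [set y in A | L p x y].
pose P (u : T * T) := [&& u.1 \in A, u.2 \in A & u.1 != u.2].
have Pu0 : P (p0, x0) by rewrite /P /= p0A eq_sym; move: x0A; rewrite !inE andbC.
have [[p x] /and3P[/= pA xA px] pxmax] := arg_maxnP (fun u => #|K u.1 u.2|) Pu0.
have xK : x \in K p x by rewrite inE xA; apply: (sep_refl sepL) => E; rewrite E eqxx in px.
have pK : p \notin K p x.
  by rewrite inE pA; apply/negP => /(sep_sym sepL) /(sep_neq sepL).
have [q qA /andP[qp qK]] : exists2 q, q \in A & (q != p) && (q \notin K p x).
  apply/exists_inP; apply: contraT; rewrite negb_exists_in => /forall_inP H.
  have LK y : y \in A :\ p -> L p x y.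
    rewrite in_setD1 => /andP[yp yA]; have := H y yA; rewrite yp negbK inE.
    by case/andP.
  have := noend p; rewrite pA => /negP; case.
  apply/forall_inP => y /LK Ly; apply/forall_inP => z /LK Lz.
  exact: (sep_trans sepL (sep_sym sepL Ly) Lz).
(* Otherwise [L v x p], and then [K v x] contains [K p x] and also [p], against maximality. *)
have Kclosed v y : v \in A -> v \notin K p x -> y \in A -> L v x y -> y \in K p x.
  move=> vA vK yA Lxy; rewrite inE yA /=.
  have [Lxp|//] := sep_split sepL p Lxy.
  have xv : v != x by apply: contra vK => /eqP->.
  have := pxmax (v, x); rewrite /P /= vA xA xv /= => /(_ isT).
  rewrite leqNgt => /negP; case; apply/proper_card/properP; split.
    apply/subsetP => z; rewrite !inE => /andP[zA Lz]; rewrite zA /=.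
    have [Lv|//] := sep_split sepL v Lz.
    by move: vK; rewrite inE vA Lv.
  by exists p => //; rewrite inE pA.
have sKA : K p x \subset A by apply/subsetP => y; rewrite inE => /andP[].
have [|g gg] := IH (A :\: K p x).
  by apply/proper_card/properP; rewrite subsetDl; split=> //; exists x; rewrite // inE xK.
have [|h gh] := IH (p |: K p x).
  apply/proper_card/properP; rewrite subUset sub1set pA sKA; split=> //.
  by exists q; rewrite // in_setU1 (negPf qp).
apply: (@ranking_module A (A :\: K p x) p g h) => //.
- exact: subsetDl.
- by rewrite in_setD pK.
(* Since [v] is outside [K p x], splitting gives [L v x z]; with [L v y z] this yields [L v x y], so
   [Kclosed] would put [y] in [K p x]. *)
- move=> v y z; rewrite setDDr setDv set0U.
  move=> /setDP[vA vK] /setDP[yA yK] /setIP[zA zK]; apply/negP => Lyz.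
  have Lxz : L v x z.
    move: zK; rewrite inE => /andP[_ Lxz].
    have [Lxv|//] := sep_split sepL v Lxz.
    by move: vK; rewrite inE vA Lxv.
  move/negP: yK; apply; apply: (Kclosed v) => //.
  exact: (sep_trans sepL Lxz (sep_sym sepL Lyz)).
- by rewrite setDDr setDv set0U (setIidPr sKA).
Qed.

End FiniteRank.

(* Compactness: from finite sets to all of [W] *)
From mathcomp Require Import classical_sets boolp filter.

Local Open Scope classical_set_scope.

Lemma seq_rank (W : choiceType) (L : W -> W -> W -> Prop) (s : seq W) :
    separation L ->
  exists f : W -> nat, {in s &, injective f} /\
    {in s & s & s, forall v x y, L v x y -> (f x < f v)%N -> (f y < f v)%N}.
Proof.
move=> sepL; pose Ls (v x y : seq_sub s) := `[< L (val v) (val x) (val y) >].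
have sepLs : separation (fun v x y => Ls v x y).
  split.
  - by move=> v x y /asboolP Lxy xv; apply: (sep_neq sepL Lxy); rewrite xv.
  - by move=> v x xv; apply/asboolP/(sep_refl sepL) => /val_inj.
  - by move=> v x y /asboolP/(sep_sym sepL)/asboolP.
  - by move=> v x y z /asboolP Lxy /asboolP Lyz; apply/asboolP/(sep_trans sepL Lxy).
  - move=> w v x y /asboolP/(sep_split sepL (val w)) [?|?].
      by left; apply/asboolP.
    by right; apply/asboolP.
  - by move=> v x y /asboolP ? /asboolP ? /asboolP; exact: (sep_asteroid sepL).
have [f [finj fL]] := ranking_exists sepLs [set: _]%SET.
exists (fun x => if insub x is Some u then f u else 0%N); split.
  move=> x y xs ys; rewrite !insubT => /finj.
  by move=> /(_ (finset.in_setT _) (finset.in_setT _)) [].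
move=> v x y vs xs ys Lxy; rewrite !insubT.
by apply: fL; rewrite ?finset.in_setT //; apply/asboolP.
Qed.

Lemma separation_order (W : choiceType) (L : W -> W -> W -> Prop) :
    separation L ->
  exists2 lt, linear_ordering lt &
    forall v x y : W, L v x y -> lt x v -> lt v y -> False.
Proof.
move=> sepL.
have [f fP] := choice (fun s : seq W => seq_rank s sepL).
pose G : set_system (seq W) :=
  filter_from [set: seq W] (fun s => [set t : seq W | {subset s <= t}]).
have GF : ProperFilter G.
  apply: filter_from_proper; last by move=> s _; exists s => x.
  apply: filter_from_filter; first by exists [::].
  move=> s t _ _; exists (s ++ t) => // u su.
  by split=> x xs; apply: su; rewrite mem_cat xs ?orbT.
have [U [UU GU]] := ultraFilterLemma GF.
have Uin (s : seq W) : U [set t : seq W | {subset s <= t}] by apply: GU; exists s.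
(* The ranking [f s] is controlled only on [s]; by [Uin], almost every [s] contains the finitely
   many points under consideration. *)
pose lt x y := U [set s | (f s x < f s y)%N].
exists lt; first split.
- split.
    by move=> x /filter_ex[s] /=; rewrite ltnn.
  move=> x y z ltxy ltyz; apply: filterS (filterI ltxy ltyz) => s [/=].
  exact: ltn_trans.
- move=> x y xy.
  have [|lexy] := in_ultra_setVsetC [set s | (f s x < f s y)%N] UU; first by left.
  right; apply: filterS (filterI lexy (Uin [:: x; y])) => s [/= /negP nlt ss].
  rewrite ltn_neqAle leqNgt nlt andbT; apply/eqP => fyx; apply: xy.
  have [finj _] := fP s.
  by apply: finj => //; apply: ss; rewrite !inE eqxx ?orbT.
- move=> v x y Lxy ltxv ltvy.
  have [s [[/= lt1 lt2] ss]] := filter_ex (filterI (filterI ltxv ltvy) (Uin [:: v; x; y])).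
  have [_ fL] := fP s.
  have : (f s y < f s v)%N.
    by apply: (fL v x y) => //; apply: ss; rewrite !inE eqxx ?orbT.
  lia.
Qed.

(** * Connected sets and linkage *)

Section Connected.

Variables (W : Type) (F : set (set W)).

Lemma F_connectedP (X : set W) : F_connected F X <->
  forall A : set W, X `&` A !=set0 -> X `\` A !=set0 ->
    exists S, [/\ F S, S `<=` X, S `&` A !=set0 & S `\` A !=set0].
Proof.
split=> [FX A XA XNA|H A B AB AB0 [a Aa] [b Bb]].
  have [||S [FS SX [a [Sa [_ Aa]]] [b [Sb [_ Ab]]]]] := FX _ _ _ _ XA XNA.
  - exact: setUIDK.
  - by apply/seteqP; split=> // z [[_ Az] [_]].
  - by exists S; split=> //; [exists a|exists b].
have NA x : B x -> ~ A x by move=> Bx Ax; have : set0 x by rewrite -AB0.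
have [||S [FS SX SA [c [Sc NAc]]]] := H A.
- by exists a; split=> //; rewrite -AB; left.
- by exists b; split; [rewrite -AB; right|exact: NA].
exists S; split=> //; exists c; split=> //.
by have := SX _ Sc; rewrite -AB => -[].
Qed.

(** A common point lies on one side of the cut [A]; whichever of [X], [Y] has a point on the other
    side is itself cut by [A]. *)
Lemma F_connectedU (X Y : set W) : F_connected F X -> F_connected F Y ->
  X `&` Y !=set0 -> F_connected F (X `|` Y).
Proof.
move=> /F_connectedP FX /F_connectedP FY [p [Xp Yp]]; apply/F_connectedP => A.
move=> [a [XYa Aa]] [b [XYb Ab]].
suff [Z [ZXY FZ ZA ZNA]] : exists Z, [/\ Z `<=` X `|` Y,
    forall A : set W, Z `&` A !=set0 -> Z `\` A !=set0 ->
      exists S, [/\ F S, S `<=` Z, S `&` A !=set0 & S `\` A !=set0],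
    Z `&` A !=set0 & Z `\` A !=set0].
  have [S [FS SZ SA SNA]] := FZ A ZA ZNA.
  by exists S; split=> //; apply: subset_trans ZXY.
have [Ap|Ap] := pselect (A p).
  case: XYb => [Xb|Yb].
    by exists X; split; [exact: subsetUl| |exists p|exists b].
  by exists Y; split; [exact: subsetUr| |exists p|exists b].
case: XYa => [Xa|Ya].
  by exists X; split; [exact: subsetUl| |exists a|exists p].
by exists Y; split; [exact: subsetUr| |exists a|exists p].
Qed.

Definition linked (v x y : W) : Prop :=
  exists X, [/\ F_connected F X, X x, X y & ~ X v].

(** Singletons give reflexivity, unions through the shared point give transitivity, and splitting
    asks whether the witness contains [w]. *)
Lemma linked_separation :
  (forall v x y, linked v x y -> linked x v y -> linked y v x -> False) ->
  separation linked.
Proof.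
move=> Nast; split=> //.
- by move=> v x y [X [_ Xx _ Xv]] xv; rewrite -xv in Xv.
- move=> v x xv; exists [set x]; split=> //; last by move=> /esym.
  by apply/F_connectedP => A [_ [/= -> Ax]] [_ [/= ->]].
- by move=> v x y [X [FX Xx Xy Xv]]; exists X.
- move=> v x y z [X [FX Xx Xy Xv]] [Y [FY Yy Yz Yv]].
  exists (X `|` Y); split; [|by left|by right|by case].
  by apply: F_connectedU => //; exists y.
- move=> w v x y [X [FX Xx Xy Xv]].
  by have [Xw|Xw] := pselect (X w); [left|right]; exists X.
Qed.

Lemma F_connected_mem (S : set W) : F S -> F_connected F S.
Proof. by move=> FS; apply/F_connectedP => A SA SNA; exists S; split=> // x. Qed.

(** Cut the witness at [v]: a member of [F] inside it with points on both sides would, by convexity,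
    contain [v]. *)
Lemma order_not_linked (lt : W -> W -> Prop) : linear_ordering lt ->
    (forall S, F S -> order_interval lt S) ->
  forall v x y, lt x v -> lt v y -> ~ linked v x y.
Proof.
move=> [[ltI ltT] ltC] Flt v x y ltxv ltvy [X [/F_connectedP FX Xx Xy Xv]].
have [||S [FS SX [a [Sa av]] [b [Sb bv]]]] := FX [set z | lt z v].
- by exists x.
- by exists y; split=> // /= ltyv; apply: (ltI v); exact: ltT ltvy ltyv.
apply/Xv/SX/(Flt S FS a v b) => //.
have [//|/bv//] : lt v b \/ lt b v.
by apply: ltC => vb; apply/Xv/SX; rewrite vb.
Qed.

End Connected.

Theorem mainTheorem5 (W : Type) (F : set (set W)) :
  (exists lt : W -> W -> Prop,
     linear_ordering lt /\ forall S : set W, F S -> order_interval lt S)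
  <->
  ~ (exists (v : 'I_3 -> W) (X : 'I_3 -> set W),
       [/\ injective v,
           forall i : 'I_3, F_connected F (X i)
         & forall i j : 'I_3, X j (v i) <-> i <> j]).
Proof.
split=> [[lt [ltP Flt]] [v [X [vinj FX XP]]]|Nast].
  have mid i j k : i <> j -> k <> j -> lt (v i) (v j) -> lt (v j) (v k) -> False.
    move=> ij kj lij ljk; apply: (order_not_linked ltP Flt lij ljk).
    by exists (X j); split=> //; [apply/XP|apply/XP|move=> /XP].
  have [_ ltC] := ltP.
  pose a : 'I_3 := @Ordinal 3 0 isT; pose b : 'I_3 := @Ordinal 3 1 isT.
  pose c : 'I_3 := @Ordinal 3 2 isT.
  have ltv i j : i <> j -> lt (v i) (v j) \/ lt (v j) (v i).
    by move=> ij; apply: ltC => /vinj.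
  have [ab bc ac] : [/\ a <> b, b <> c & a <> c] by [].
  (* Any orientation of the three pairs contains a directed path through all three points, whose
     middle point [mid] rules out. *)
  have [lab|lba] := ltv _ _ ab; have [lbc|lcb] := ltv _ _ bc;
    have [lac|lca] := ltv _ _ ac; by [
      apply: mid lab lbc => // /esym | apply: mid lcb lba => // /esym |
      apply: mid lba lac => // /esym | apply: mid lca lab => // /esym |
      apply: mid lac lcb => // /esym | apply: mid lbc lca => // /esym ].
have sepF : separation (linked F).
  apply: linked_separation => v x y [X0 [F0 x0 y0 v0]] [X1 [F1 v1 y1 x1]].
  move=> [X2 [F2 v2 x2 y2]]; apply: Nast.
  (* The sets are listed so that the one at index [i] misses the point at index [i]; the [nth]
     defaults are never reached. *)
  exists (fun i : 'I_3 => nth v [:: v; x; y] i).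
  exists (fun i : 'I_3 => nth set0 [:: X0; X1; X2] i); split.
  - have vx : v <> x by move=> E; rewrite E in v0.
    have vy : v <> y by move=> E; rewrite E in v0.
    have xy : x <> y by move=> E; rewrite E in x1.
    by move=> [[|[|[|i]]] Hi] [[|[|[|j]]] Hj] //= E; try apply/val_inj => //=;
      exfalso; auto.
  - by move=> [[|[|[|i]]] Hi].
  - by move=> [[|[|[|i]]] Hi] [[|[|[|j]]] Hj] //=; split=> // E; case: E;
      exact/val_inj.
have [lt ltP ltN] := @separation_order {classic W} _ sepF.
exists lt; split=> // S FS x v y Sx Sy ltxv ltvy; apply: contrapT => Sv.
by apply: (ltN v x y) => //; exists S; split=> //; exact: F_connected_mem.
Qed.
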